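(* If $X$ is an infinite isodyne topological space, then for every natural number $n$ the space $X^n$ (with the product topology) is $n!$-resolvable.
   Context: For a topological space $X$, the dispersion character is $\Delta(X) = \min\{|U| : U \text{ is a nonempty open subset of } X\}$. A space $X$ is isodyne if $|X| = \Delta(X)$. For a cardinal $\kappa$, a space $X$ is $\kappa$-resolvable if $X$ can be partitioned into $\kappa$-many (pairwise disjoint) dense subsets. No separation axioms are assumed. *)

(* Defs.v *)
From HB Require Import structures.
From mathcomp Require Import all_boot all_order all_algebra.
From mathcomp Require Import all_classical all_reals topology.

Set Implicit Arguments.
Unset Strict Implicit.
Unset Printing Implicit Defensive.

Local Open Scope classical_set_scope.
Local Open Scope card_scope.

(* Cardinals are not objects of the library, so a cardinal is given by a set K
   having that cardinality: "|K| is the least cardinality of a nonempty open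
   subset of X". *)
Definition is_dispersion_character (X : topologicalType) (T : Type)
    (K : set T) : Prop :=
  (exists U : set X, [/\ open U, U !=set0 & K #= U]) /\
  (forall U : set X, open U -> U !=set0 -> K #<= U).

Lemma is_dispersion_character_unique (X : topologicalType) (S T : Type)
    (K : set S) (L : set T) :
  is_dispersion_character X K -> is_dispersion_character X L -> K #= L.
Proof.
move=> [[U [oU U0 KU]] minK] [[V [oV V0 LV]] minL].
rewrite card_eq_le; apply/andP; split.
- by rewrite (card_le_eqr LV); exact: minK.
- by rewrite (card_le_eqr KU); exact: minL.
Qed.

Definition isodyne (X : topologicalType) : Prop :=
  is_dispersion_character X [set: X].

(* The cardinal kappa is given by an index type K. The parts of a partition are
   nonempty and pairwise disjoint, so there are exactly |K| of them. *)
Definition resolvable (K : Type) (X : topologicalType) : Prop :=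
  exists D : K -> set X,
    partition [set: K] D [set: X] /\ forall k : K, dense (D k).

(* Main.v *)
From HB Require Import structures.
Require Import Defs.
From mathcomp Require Import all_boot all_order all_algebra.
From mathcomp Require Import all_classical all_reals topology.
From mathcomp Require Import perm wochoice.

(** The points of the power are classified by the order type of their
    coordinates. Well-order [X] so that every initial segment has fewer than
    [|X|] points; then a set of cardinality [|X|] has elements strictly above
    any given point ([exists_order_full_cofinal]). In an isodyne space every
    nonempty open set has cardinality [|X|], hence has this property.

    For a permutation [s], let [D s] be the set of points [p] whose coordinates
    are strictly ordered as the values of [s]: [p j] is below [p i] exactly when
    [s j < s i]. These [n!] sets are pairwise disjoint. Each of them is dense:
    a nonempty open set contains a nonempty open box ([nbhs_ptws_box]), and the
    coordinates can be chosen in its sides one after the other, in the order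
    that [s] prescribes, each above the previous one ([increasing_choice]).
    The points with repeated coordinates are thrown into one of the parts,
    which does not affect density. *)

Local Open Scope classical_set_scope.

(** The point [u0] is there because a total function into an empty [U] need not
    exist, even when [A] is empty. *)
Lemma card_le_injfunP (T : Type) (U : choiceType) (u0 : U) (A : set T)
    (B : set U) :
  (A #<= B)%card <-> exists2 f : T -> U, set_fun A B f & set_inj A f.
Proof.
pose pU : pointedType := HB.pack U (isPointed.Build U u0).
by rewrite -injfunPex; split=> /(@pcard_leP T pU).
Qed.

(** Hilbert's hotel: shift [A] along an injective sequence that starts at
    [x], and fix the points off that sequence. *)
Lemma infinite_card_le_setD1 (T : choiceType) (A : set T) (x : T) :
  infinite_set A -> (A #<= A `\ x)%card.
Proof.
move=> Ainf; have [Ax|Ax] := pselect (A x); last first.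
  by apply: subset_card_le => y Ay; split=> // yx; apply: Ax; rewrite -yx.
have /infiniteP/(card_le_injfunP _ _ x)[/= e eA einj] : infinite_set (A `\ x).
  by apply: infinite_setD.
pose s k := if k is k'.+1 then e k' else x.
have sA k : A (s k) by case: k => //= k; case: (eA k).
have s_inj : injective s.
  move=> [|i] [|j] /= => [//|xe|ex|eij].
  - by have [_ []] := eA j Logic.I.
  - by have [_ []] := eA i Logic.I.
  - by rewrite (einj i j (in_setT i) (in_setT j) eij).
pose h y := if pselect (exists k, s k = y) is left H
            then s (projT1 (cid H)).+1 else y.
apply/(card_le_injfunP _ _ x); exists h.
  move=> y Ay; rewrite /h; case: pselect => [H|H].
    by split; [exact: sA|move=> /(s_inj _.+1 0)].
  by split=> // yx; apply: H; exists 0.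
move=> y z _ _; rewrite /h.
case: pselect => [Hy|Hy]; case: pselect => [Hz|Hz] //.
- by case: (cid Hy) (cid Hz) => [i iy] [j jz] /s_inj[ij]; rewrite -iy ij.
- by case: (cid Hy) => i /= _ eqz; case: Hz; exists i.+1.
- by case: (cid Hz) => i /= _ eqy; case: Hy; exists i.+1.
Qed.

(** Let [W] be a well-order, and call [m] full if its closed initial segment has
    the cardinality of [T]. If there is no full point, [W] itself will do.
    Otherwise let [m] be the least full point: the open segment below [m] still
    has the cardinality of [T], as [T] is infinite, and its points are not full,
    so [T] embeds into it and the order can be pulled back. The segments are
    taken closed because the complement of a closed segment consists of strict
    upper bounds. *)
Lemma exists_order_full_cofinal (T : choiceType) :
  infinite_set [set: T] ->
  exists R : rel T, [/\ irreflexive R, transitive R &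
    forall V : set T, ([set: T] #<= V)%card ->
      forall x, exists2 y, V y & R x y].
Proof.
move=> Tinf; have [W Wwo] := well_ordering_principle T.
have WwoC : wo_chain W predT by move=> A _; exact: Wwo.
have Wtot x y : W x y || W y x by apply: (wo_chainW WwoC).
have Wanti x y : W x y -> W y x -> x = y.
  by move=> xy yx; apply: (wo_chain_antisymmetric WwoC) => //; rewrite xy yx.
have Wtrans y x z : W x y -> W y z -> W x z.
  move=> xy yz.
  (* Whichever of the three points is the least, transitivity follows. *)
  have [|m [[mA m_min] _]] := Wwo [pred t | [|| t == x, t == y | t == z]].
    by exists x; rewrite inE eqxx.
  have mx : W m x by apply: m_min; rewrite inE eqxx.
  have my : W m y by apply: m_min; rewrite inE eqxx orbT.
  have mz : W m z by apply: m_min; rewrite inE eqxx !orbT.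
  case/or3P: mA => /eqP mE; first by rewrite -mE.
  - by rewrite (Wanti x y xy) // -mE.
  - by rewrite (Wanti y z yz) in xy * => //; rewrite -mE.
pose full := [pred x | `[< ([set: T] #<= [set y | W y x])%card >]].
have [f [f_inj f_small]] : exists f : T -> T, injective f /\
    forall x, ~ ([set: T] #<= [set y | W y (f x)])%card.
  have [[x xfull]|no_full] := pselect (nonempty full); last first.
    by exists id; split=> // x xfull; apply: no_full; exists x; apply/asboolP.
  have [m [[/asboolP mfull m_min] _]] := Wwo full (ex_intro _ x xfull).
  have seg_inf : infinite_set [set y | W y m].
    by apply/infiniteP; apply: card_le_trans mfull; apply/infiniteP.
  have /(card_le_injfunP _ _ x)[/= f fseg finj] :=
    card_le_trans mfull (infinite_card_le_setD1 _ _ m seg_inf).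
  exists f; split=> [y z|y yfull]; first by apply: finj; rewrite in_setT.
  have [Wfm] := fseg y Logic.I; apply; apply: Wanti => //.
  exact/m_min/asboolP.
exists (fun x y => ~~ W (f y) (f x)); split.
- by move=> x; rewrite /= -[W _ _]orbb Wtot.
- move=> y x z /= nyx nzy; apply/negP => zx; move/negP: nzy; apply.
  by apply: Wtrans zx _; have := Wtot (f x) (f y); rewrite (negbTE nyx) orbF.
move=> V Vfull x; apply: contrapT => noy; apply: (f_small x).
apply: card_le_trans Vfull _; apply/(card_le_injfunP _ _ x); exists f.
  by move=> y Vy; apply/negPn/negP => nW; apply: noy; exists y.
by move=> y z _ _ /f_inj.
Qed.

Lemma increasing_choice (T : Type) (R : rel T) (V : nat -> set T) (x0 : T) :
  transitive R -> (forall k x, exists2 y, V k y & R x y) ->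
  exists g : nat -> T,
    (forall k, V k (g k)) /\ {homo g : i j / i < j >-> R i j}.
Proof.
move=> Rtrans /(_ _ _)/cid2-Vcof.
pose next k x := s2val (Vcof k x).
have nextP k x : V k (next k x) /\ R x (next k x).
  by rewrite /next; case: (Vcof k x).
pose g := fix g k := next k (if k is k'.+1 then g k' else x0).
exists g; split=> [k|].
  by case: k => [|k] /=; exact: (nextP _ _).1.
by apply: homo_ltn => // i; exact: (nextP _ _).2.
Qed.

(** The boxes around [p] form a filter base, and the filter that they generate
    converges to [p] coordinatewise, hence in the product topology. *)
Lemma nbhs_ptws_box (I : eqType) (X : topologicalType) (O : set {ptws I -> X})
    (p : {ptws I -> X}) :
  nbhs p O -> exists U : I -> set X,
    (forall i, open (U i) /\ U i (p i)) /\
    forall f : {ptws I -> X}, (forall i, U i (f i)) -> O f.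
Proof.
pose box (U : I -> set X) : set {ptws I -> X} := [set f | forall i, U i (f i)].
pose D := [set U : I -> set X | forall i, open (U i) /\ U i (p i)].
pose F := filter_from D box.
have FF : Filter F.
  apply: filter_from_filter.
    by exists (fun=> setT) => i; split=> //; exact: openT.
  move=> U V DU DV; exists (fun i => U i `&` V i).
    move=> i; have [? ?] := DU i; have [? ?] := DV i.
    by split=> //; exact: openI.
  by move=> f UV; split=> i; have [] := UV i.
suff : F --> p by move=> /[apply] -[U DU UO]; exists U; split.
apply/cvg_sup => i A /= [_ [[Q oQ <-] Qp] QA].
exists (fun j => if j == i then Q else setT).
  by move=> j; case: eqP => [->|_]; split=> //; exact: openT.
by move=> f /(_ i); rewrite eqxx => /QA.
Qed.

(** The permutation sending [i] to the rank of [p i] among the coordinates of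
    [p]. If coordinates are repeated, the ranks may fail to form a permutation;
    the value is then the identity. *)
Definition order_pattern (T : Type) (R : rel T) (n : nat) (p : 'I_n -> T) :
    'S_n :=
  odflt 1%g [pick s : 'S_n | [forall i, #|[set j | R (p j) (p i)]%SET| == s i]].

Lemma card_ord_lt (n m : nat) : m <= n -> #|[set k : 'I_n | k < m]%SET| = m.
Proof.
by move=> mn; rewrite -sum1dep_card (big_ord_narrow mn) sum1_card card_ord.
Qed.

(** Along an increasing [g] the rank of [g (s i)] is the number of values of [s]
    below [s i], which is [s i] because [s] is onto. *)
Lemma order_pattern_comp (T : Type) (R : rel T) (n : nat) (s : 'S_n)
    (g : nat -> T) :
  irreflexive R -> transitive R -> {homo g : i j / i < j >-> R i j} ->
  order_pattern T R n (fun i => g (s i)) = s.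
Proof.
move=> Rirr Rtrans gR.
have gE i j : R (g i) (g j) = (i < j).
  case: (ltngtP i j) => [/gR//|ji|->]; last exact: Rirr.
  apply/negP => ij; have := Rirr (g i).
  by rewrite (Rtrans (g j) (g i) (g i) ij) ?gR.
have cardE i : #|[set j | R (g (s j)) (g (s i))]%SET| = s i.
  rewrite -[RHS](@card_ord_lt n) ?[s i <= n]ltnW //.
  rewrite -(card_preimset [set k : 'I_n | k < s i]%SET (@perm_inj _ s)).
  by apply: eq_card => j; rewrite !inE gE.
rewrite /order_pattern; case: pickP => [t /forallP tE|/(_ s)] /=.
  by apply/permP => i; apply/val_inj; rewrite /= -(eqP (tE i)) cardE.
by move/negP; case; apply/forallP => i; rewrite cardE.
Qed.

(** Fibers of a map are disjoint and cover, so that only density needs to be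
    checked; it also makes the fibers nonempty. *)
Lemma resolvable_fibers (K : Type) (X : topologicalType) (c : X -> K) :
  [set: X] !=set0 -> (forall k, dense (c @^-1` [set k])) -> resolvable K X.
Proof.
move=> X0 cdense; exists (fun k => c @^-1` [set k]); split=> //; split.
- by apply/seteqP; split=> // x _; exists (c x).
- exact: trivIset_preimage1.
- by move=> k _; have [x []] := cdense k _ X0 openT; exists x.
Qed.

Theorem theorem1p1 (X : topologicalType) (X_infinite : infinite_set [set: X])
    (X_isodyne : isodyne X) (n : nat) :
  resolvable 'I_(n`!) {ptws 'I_n -> X}.
Proof.
have [R [Rirr Rtrans Rcof]] := exists_order_full_cofinal X X_infinite.
have [x0 _] := infinite_setN0 X_infinite.
have card_perm : #|'S_n| = n`! by rewrite card_Sn.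
pose index (s : 'S_n) : 'I_(n`!) := cast_ord card_perm (enum_rank s).
apply: (@resolvable_fibers 'I_(n`!) {ptws 'I_n -> X}
  (fun p => index (order_pattern X R n p))).
  by exists (fun=> x0).
move=> k O [p Op] oO.
pose s : 'S_n := enum_val (cast_ord (esym card_perm) k).
have [U [oU UO]] : exists U : 'I_n -> set X,
    (forall i, open (U i) /\ U i (p i)) /\
    forall f : {ptws 'I_n -> X}, (forall i, U i (f i)) -> O f.
  by apply: nbhs_ptws_box; apply: open_nbhs_nbhs.
(* The coordinate of rank [j] is [s^-1 j]; ranks from [n] on are unconstrained,
   so that the choice can be made along all of [nat]. *)
pose V j := if [pick i | s i == j :> nat] is Some i then U i else setT.
have Vcof j x : exists2 y, V j y & R x y.
  apply: Rcof; rewrite /V; case: pickP => [i _|//].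
  by have [? ?] := oU i; apply: X_isodyne.2 => //; exists (p i).
have [g [Vg gR]] := increasing_choice X R V x0 Rtrans Vcof.
exists (fun i => g (s i)); split.
  apply: UO => i; have := Vg (s i); rewrite /V.
  case: pickP => [i' /eqP/val_inj/perm_inj-> //|/(_ i)].
  by rewrite eqxx.
by rewrite /= order_pattern_comp// /index /s enum_valK cast_ordKV.
Qed.
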